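(* Let $C\subset\mathbb R$ be a Cantor set with $d=\operatorname{diam}(C)>0$ and thickness $$\tau(C)\ge\frac{1-0.015}{2(0.015)}=32.83333\ldots$$ Then $(0,\,0.3\,d]\subseteq G^4_{AP}(C)$.
   Context: For compact $C\subset\mathbb R$, $G^4_{AP}(C):=\{t>0:\exists x\in\mathbb R\text{ with }x,x+t,x+2t,x+3t\in C\}$. Write $|E|=\operatorname{diam}(E)$. Thickness $\tau$: a set $P$ is a chunk of $C$ (written $P\propto C$) if $P=C\cap I$ for some closed interval $I$, $P$ is a nonempty proper subset of $C$, and $d(P,C\setminus P)>0$. If $C$ has a chunk, $\tau(C)=\inf_{P\propto C}|P|/d(P,C\setminus P)$; otherwise $\tau(C)=0$ if $C$ is empty or a single point and $\tau(C)=\infty$ if $C$ is an interval of positive length. (This is equivalent to the usual Newhouse bridge/gap thickness.) *)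

(* Defs.v *)
From HB Require Import structures.
From mathcomp Require Import all_boot all_order all_algebra.
From mathcomp Require Import all_classical all_reals all_analysis.
Import Order.TTheory GRing.Theory Num.Theory.
Import numFieldNormedType.Exports.

Set Implicit Arguments.
Unset Strict Implicit.
Unset Printing Implicit Defensive.

Local Open Scope classical_set_scope.
Local Open Scope ring_scope.

Definition cantor_set (R : realType) (C : set R) : Prop :=
  [/\ C !=set0, compact C, perfect_set C & totally_disconnected C].

(* [sup] is real-valued, so this is the diameter only when E is bounded
   (and it is 0 when E is empty). *)
Definition diam (R : realType) (E : set R) : R :=
  sup [set `|x - y| | x in E & y in E].

(* The distance between A and B when both are nonempty. *)
Definition set_dist (R : realType) (A B : set R) : R :=
  inf [set `|x - y| | x in A & y in B].

(* Inverted endpoints a > b are harmless: `[a, b] is then empty, and P is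
   required to be nonempty. *)
Definition chunk (R : realType) (C P : set R) : Prop :=
  [/\ exists a b : R, P = C `&` `[a, b],
      P !=set0,
      P `<` C &
      0 < set_dist P (C `\` P)].

(* Meant for compact C. A compact set without chunks is empty, a singleton, or
   an interval of positive length; the last case is the final branch. *)
Definition thickness (R : realType) (C : set R) : \bar R :=
  if `[< exists P, chunk C P >] then
    ereal_inf [set (diam P / set_dist P (C `\` P))%:E | P in chunk C]
  else if `[< exists x, C `<=` [set x] >] then 0%E
  else +oo%E.

Definition G4AP (R : realType) (C : set R) : set R :=
  [set t | 0 < t /\
     exists x, [/\ C x, C (x + t), C (x + 2 * t) & C (x + 3 * t)]].

(* Main.v *)
Require Import Defs.
From HB Require Import structures.
From mathcomp Require Import all_boot all_order all_algebra.
From mathcomp Require Import all_classical all_reals all_analysis.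
From mathcomp Require Import lra.
Import Order.TTheory GRing.Theory Num.Theory.
Import numFieldNormedType.Exports.

Local Open Scope classical_set_scope.
Local Open Scope ring_scope.

(* Put F i = C - i t for i < 4, [m, M] = hull of C; a common point of the F i in
   J = [m, M - 3 t] starts the progression. Thickness 31 says that a gap of
   length g is at distance at least 31 g from every gap of the same set that is
   at least as long, and from the ends of the hull. To avoid all gaps of length
   at least e, repeatedly delete from J the longest gap that meets it and keep
   the longer remaining piece. The sets F a and F b to which the gaps at the two
   ends of J belong have only gaps of length at most |J| / 31 inside J. A cut by
   a gap of a third set puts that set in place of a or b; the replaced set then
   still has only short gaps, and this compensates the halving of J. The
   bounds in [balanced] are preserved by each cut, so the process goes on until
   the finitely many long gaps are exhausted; then e tends to 0. *)

(** * Gaps and the invariants of the cutting process *)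

Definition gap {R : realType} (A : set R) (u v : R) : Prop :=
  [/\ A u, A v, u < v & forall x, u < x -> x < v -> ~ A x].

Definition gaps_le {R : realType} (A : set R) (l r b : R) : Prop :=
  forall u v, gap A u v -> l < v -> u < r -> v - u <= b.

(* Holds when a gap of A at least as long as those meeting [l, r], possibly
   unbounded, ends at l. *)
Definition left_clear {R : realType} (A : set R) (l r : R) : Prop :=
  forall u v, gap A u v -> l < v -> u < r -> 31 * (v - u) <= u - l.

Definition right_clear {R : realType} (A : set R) (l r : R) : Prop :=
  forall u v, gap A u v -> l < v -> u < r -> 31 * (v - u) <= r - v.

Definition separated {R : realType} (A : set R) : Prop :=
  forall u v u' v', gap A u v -> gap A u' v' -> v <= u' ->
    31 * Num.min (v - u) (v' - u') <= u' - v.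

(* B j x: the gaps of the j-th set meeting the current interval, of length L,
   have length at most x; a and b are the sets adjacent to its two ends. The
   first state follows a cut by a or b, whose gap is at most L / 31 and hence
   bounds all others; a further cut by another set leads to the second state,
   and then to the third, which reproduces itself. *)
Definition balanced {R : realType} (B : 'I_4 -> R -> Prop) (a b : 'I_4) (L : R)
    : Prop :=
  [\/ forall j, j != a -> j != b -> B j (L / 15),
      a != b /\ forall j, j != a -> j != b -> B j (L / 7) |
      a != b /\ exists2 c, B c (L / 3) &
        forall j, j != a -> j != b -> j != c -> B j (L / 9)].

(** * Effect of one cut on the length bounds *)

Lemma balanced_sym {R : realType} (B : 'I_4 -> R -> Prop) a b L :
  balanced B a b L -> balanced B b a L.
Proof.
case=> [h|[ab h]|[ab [c hc h]]].
- by constructor 1 => j ja jb; exact: h.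
- by constructor 2; split=> [|j ja jb]; [rewrite eq_sym|exact: h].
- constructor 3; split; first by rewrite eq_sym.
  by exists c => // j ja jb jc; exact: h.
Qed.

Lemma balanced_mono {R : realType} (B B' : 'I_4 -> R -> Prop) a b L :
  (forall j x, B j x -> B' j x) -> balanced B a b L -> balanced B' a b L.
Proof.
move=> BB [h|[ab h]|[ab [c hc h]]].
- by constructor 1 => j ja jb; apply/BB/h.
- by constructor 2; split=> // j ja jb; apply/BB/h.
- constructor 3; split=> //.
  by exists c; [exact: BB|move=> j ja jb jc; apply/BB/h].
Qed.

Lemma ord4_fourth (a b c : 'I_4) : a != b -> c != a -> c != b ->
  exists d, [/\ d != a, d != b, d != c &
    forall j, [|| j == a, j == b, j == c | j == d]].
Proof.
move=> ab ca cb.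
have : #|~: [set a; b; c]%SET| = 1%N.
  have := cardsC [set a; b; c]%SET.
  rewrite card_ord -finset.setUA cardsU1 cardsU1 cards1.
  by rewrite !inE negb_or ab (eq_sym a c) ca (eq_sym b c) cb /= => -[].
move/eqP/cards1P=> [d hd]; exists d.
have := set11 d; rewrite -hd !inE !negb_or => /andP[/andP[da db] dc].
split=> // j; have := finset.in_set1 j d; rewrite -hd !inE !negb_or.
by do 3 case: eqP => //= _.
Qed.

(** Ensures that a cut by any of the four sets removes at most a third of the interval, so that the
    longer remaining piece is nondegenerate. *)
Lemma balanced_third {R : realType} (B : 'I_4 -> R -> Prop) a b L :
  (forall j x y, B j x -> x <= y -> B j y) -> 0 < L ->
  B a (L / 31) -> B b (L / 31) -> balanced B a b L ->
  forall i, B i (L / 3).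
Proof.
move=> Bm L0 Ba Bb bal i.
have [->|ia] := eqVneq i a; first by apply: Bm Ba _; lra.
have [->|ib] := eqVneq i b; first by apply: Bm Bb _; lra.
case: bal => [h|[ab h]|[ab [c hc h]]].
- by apply: Bm (h _ ia ib) _; lra.
- by apply: Bm (h _ ia ib) _; lra.
- have [->//|ic] := eqVneq i c.
  by apply: Bm (h _ ia ib ic) _; lra.
Qed.

(** Here [g] is the longest gap, one of set [i], and [L'] the piece kept between [a] and [i]. If
    [g <= L / (2n + 1)], then [L' >= n L / (2n + 1)], so a bound [L / (2n + 1)] becomes [L' / n]:
    this gives the chain 31, 15, 7, 3. The replaced set [b] brings the bound [L / 31]. *)
Lemma balanced_cut {R : realType} (B : 'I_4 -> R -> Prop) a b i (L L' g : R) :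
  (forall j x y, B j x -> x <= y -> B j y) -> 0 < L ->
  B a (L / 31) -> B b (L / 31) -> balanced B a b L ->
  (forall x, B i x -> g <= x) -> (forall j, B j g) ->
  (L - g) / 2 <= L' -> balanced B a i L'.
Proof.
move=> Bm L0 Ba Bb bal gi Bg LL'.
have small : g <= L / 31 -> balanced B a i L'.
  by move=> gL; constructor 1 => j _ _; apply: Bm (Bg j) _; lra.
have [ia|ia] := eqVneq i a; first by apply/small/gi; rewrite ia.
have [ib|ib] := eqVneq i b; first by apply/small/gi; rewrite ib.
have ai : a != i by rewrite eq_sym.
case: bal => [h|[ab h]|[ab [c hc h]]].
- have gL := gi _ (h _ ia ib).
  constructor 2; split=> // j ja ji.
  have [->|jb] := eqVneq j b; first by apply: Bm Bb _; lra.
  by apply: Bm (h _ ja jb) _; lra.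
- have gL := gi _ (h _ ia ib).
  have [d [da db di hd]] := ord4_fourth _ _ _ ab ia ib.
  constructor 3; split=> //; exists d; first by apply: Bm (h _ da db) _; lra.
  move=> j ja ji jd; have := hd j.
  rewrite (negbTE ja) (negbTE ji) (negbTE jd) /= orbF => /eqP ->.
  by apply: Bm Bb _; lra.
(* Now [L' >= L / 3], so the bound [L / 31] of [b] is below [L' / 9], and a bound [L / 9] is at most
   [L' / 3]. If the remaining set [d] is the exceptional [c], then [i] is not, so [g <= L / 9], and
   [g] itself bounds [d]. *)
- have gL : g <= L / 3.
    have [ic|ic] := eqVneq i c; first by apply: gi; rewrite ic.
    by apply: le_trans (gi _ (h _ ia ib ic)) _; lra.
  have [d [da db di hd]] := ord4_fourth _ _ _ ab ia ib.
  constructor 3; split=> //; exists d.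
    have [dc|dc] := eqVneq d c; last by apply: Bm (h _ da db dc) _; lra.
    have ic : i != c by rewrite -dc eq_sym.
    by apply: Bm (Bg d) _; have := gi _ (h _ ia ib ic); lra.
  move=> j ja ji jd; have := hd j.
  rewrite (negbTE ja) (negbTE ji) (negbTE jd) /= orbF => /eqP ->.
  by apply: Bm Bb _; lra.
Qed.

(** * Elementary facts about gaps *)

Lemma gaps_le_sub {R : realType} (A : set R) (l r l' r' b b' : R) :
  l <= l' -> r' <= r -> b <= b' -> gaps_le A l r b -> gaps_le A l' r' b'.
Proof.
move=> ll rr bb h u v g lv ur; apply: le_trans bb.
by apply: h g _ _; [apply: le_lt_trans lv|apply: lt_le_trans ur rr].
Qed.

Lemma left_clear_le {R : realType} (A : set R) (l r : R) :
  left_clear A l r -> gaps_le A l r ((r - l) / 31).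
Proof. by move=> h u v g lv ur; have := h _ _ g lv ur; lra. Qed.

Lemma right_clear_le {R : realType} (A : set R) (l r : R) :
  right_clear A l r -> gaps_le A l r ((r - l) / 31).
Proof. by move=> h u v g lv ur; have := h _ _ g lv ur; lra. Qed.

Lemma gap_after {R : realType} (A : set R) (u v u' v' : R) :
  gap A u v -> gap A u' v' -> v < v' -> v <= u'.
Proof.
move=> [_ Av _ _] [_ _ _ h'] vv'; rewrite leNgt; apply/negP => u'v.
exact: h' u'v vv' Av.
Qed.

Lemma gap_before {R : realType} (A : set R) (u v u' v' : R) :
  gap A u v -> gap A u' v' -> u' < u -> v' <= u.
Proof.
move=> [Au _ _ _] [_ _ _ h'] uu'; rewrite leNgt; apply/negP => uv'.
exact: h' uu' uv' Au.
Qed.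

(** Induction on [n] with [r - l < n e]: a gap of length at least [e] leaves on each side an
    interval shorter by at least [e], and all other gaps lie on one of the two sides. *)
Lemma gaps_finite {R : realType} (A : set R) (e l r : R) : 0 < e ->
  exists s : seq (R * R), forall u v, gap A u v -> l <= u -> v <= r ->
    e <= v - u -> (u, v) \in s.
Proof.
move=> e0; have [n] : exists n : nat, r - l < n%:R * e.
  exists (Num.bound `|(r - l) / e|); rewrite -ltr_pdivrMr //.
  by apply: le_lt_trans (ler_norm _) _; apply: archi_boundP.
elim: n l r => [|n IH] l r; rewrite ?mul0r ?mulrSr ?mulrDl ?mul1r => lr.
  by exists [::] => u v [_ _ uv _] lu vr; lra.
have [[u0 [v0 [g0 lu0 vr0 e0']]]|no] := pselect (exists u v,
    [/\ gap A u v, l <= u, v <= r & e <= v - u]); last first.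
  by exists [::] => u v g lu vr ev; case: no; exists u, v.
have uv0 : u0 < v0 by case: g0.
have [s1 h1] : exists s : seq (R * R), forall u v, gap A u v ->
    l <= u -> v <= u0 -> e <= v - u -> (u, v) \in s by apply: IH; lra.
have [s2 h2] : exists s : seq (R * R), forall u v, gap A u v ->
    v0 <= u -> v <= r -> e <= v - u -> (u, v) \in s by apply: IH; lra.
exists ((u0, v0) :: s1 ++ s2) => u v g lu vr ev.
rewrite in_cons mem_cat.
have [uu|uu|uu] := ltgtP u u0.
- by rewrite h1 ?orbT // (gap_before _ _ _ _ _ g0 g).
- have vv : v0 < v.
    rewrite ltNge; apply/negP => vv; case: g0 => _ _ _ h0.
    have [vlt|vge] := ltP v v0; first by case: g => _ Av _ _; apply: h0 Av; lra.
    by case: g => Au _ ? _; apply: h0 Au; lra.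
  by rewrite h2 ?orbT // (gap_after _ _ _ _ _ g0 g).
- suff -> : v = v0 by rewrite uu eqxx.
  apply/eqP; rewrite eq_le !leNgt; apply/andP; split; apply/negP => vv.
    by case: g0 g => _ Av _ _ [_ _ _ h]; apply: h Av; lra.
  by case: g g0 => _ Av ? _ [_ _ _ h]; apply: h Av; lra.
Qed.

(** * The cutting process *)

Lemma escape_large_gaps {R : realType} (F : 'I_4 -> set R) (e : R)
    (s : seq ('I_4 * R * R)) (l r : R) (a b : 'I_4) :
  0 < e -> (forall i, separated (F i)) ->
  sorted [rel p q | q.2 - q.1.2 <= p.2 - p.1.2] s ->
  l < r -> left_clear (F a) l r -> right_clear (F b) l r ->
  balanced (fun j => gaps_le (F j) l r) a b (r - l) ->
  (forall i u v, gap (F i) u v -> l < v -> u < r -> e <= v - u ->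
    (i, u, v) \in s) ->
  exists2 x, l <= x <= r &
    forall i u v, gap (F i) u v -> e <= v - u -> ~~ (u < x < v).
Proof.
move=> e0 sepF; elim: s l r a b => [|[[i u0] v0] s IH] l r a b.
  (* No long gap meets the open interval any more, whereas one containing [l] would. *)
  move=> _ lr _ _ _ cov; exists l; first by rewrite lexx ltW.
  move=> i u v g ev; apply/negP => /andP[ul lv].
  by have := cov i u v g lv (lt_trans ul lr) ev.
move=> srt lr la rb bal cov.
have srt' : sorted [rel p q : 'I_4 * R * R | q.2 - q.1.2 <= p.2 - p.1.2] s.
  exact: path_sorted srt.
(* A head of the list that is not a long gap meeting the current interval is skipped; otherwise it
   is the longest such gap, as the list is sorted. *)
have [[g0 lv0 ur0 ev0]|no] :=
    pselect [/\ gap (F i) u0 v0, l < v0, u0 < r & e <= v0 - u0]; last first.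
  apply: (IH l r a b) => // j u v g lv ur ev.
  have := cov j u v g lv ur ev; rewrite in_cons => /orP[/eqP[ej eu ev']|//].
  by case: no; rewrite -ej -eu -ev'.
set B := fun j => gaps_le (F j) l r.
have Bm j x y : B j x -> x <= y -> B j y by move=> h xy; apply: gaps_le_sub h.
have Ba : B a ((r - l) / 31) by apply: left_clear_le.
have Bb : B b ((r - l) / 31) by apply: right_clear_le.
have rl0 : 0 < r - l by lra.
have g0L : v0 - u0 <= (r - l) / 3.
  by apply: (balanced_third _ _ _ _ Bm rl0 Ba Bb bal i _ _ g0 lv0 ur0).
(* Gaps shorter than [e] are shorter than the cut one; the others are listed, and come after it in
   decreasing order of length. *)
have Bg j : B j (v0 - u0).
  move=> u v g lv ur; have [ev|ev] := leP e (v - u); last by lra.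
  have := cov j u v g lv ur ev; rewrite in_cons => /orP[/eqP[_ -> ->]//|js].
  have tr : transitive [rel p q : 'I_4 * R * R | q.2 - q.1.2 <= p.2 - p.1.2].
    by move=> p q w /= h1 h2; apply: le_trans h2 h1.
  by have /allP/(_ _ js) := order_path_min tr srt.
have gi x : B i x -> v0 - u0 <= x by move=> h; apply: h.
have uv0 : u0 < v0 by case: g0.
have [big|big] := leP ((r - l - (v0 - u0)) / 2) (r - v0).
- have v0r : v0 < r by lra.
  have [||||x /andP[vx xr] hx] := IH v0 r i b srt' v0r.
  (* The cut gap being the longest, the minimum in [separated] is the length of the later gap, so
     [F i] is clear at its new end [v0]. *)
  + move=> u v g v0v ur; have lv : l < v by lra.
    have := sepF i _ _ _ _ g0 g (gap_after _ _ _ _ _ g0 g v0v).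
    by rewrite (min_idPr _) //; apply: Bg g lv ur.
  + by move=> u v g v0v ur; apply: rb g _ ur; lra.
  + apply: (balanced_mono B); last first.
      (* [balanced_cut] keeps the left end, so [a] and [b] are swapped to keep the right one. *)
      apply: balanced_sym.
      exact: (balanced_cut _ _ _ _ _ _ _ Bm rl0 Bb Ba
        (balanced_sym _ _ _ _ bal) gi Bg).
    by move=> j y h; apply: (gaps_le_sub _ _ _ _ _ _ _ _ _ _ h) => //; lra.
  + move=> j u v g v0v ur ev; have lv : l < v by lra.
    have := cov j u v g lv ur ev; rewrite in_cons => /orP[/eqP[_ _ vv]|//].
    by rewrite vv ltxx in v0v.
  by exists x => //; apply/andP; split=> //; lra.
- have lu0 : l < u0 by lra.
  have [||||x /andP[lx xu] hx] := IH l u0 a i srt' lu0.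
  + by move=> u v g lv uu; apply: la g lv _; lra.
  + move=> u v g lv uu; have ur : u < r by lra.
    have := sepF i _ _ _ _ g g0 (gap_before _ _ _ _ _ g0 g uu).
    by rewrite (min_idPl _) //; apply: Bg g lv ur.
  + apply: (balanced_mono B); last first.
      by apply: (balanced_cut _ _ _ _ _ _ _ Bm rl0 Ba Bb bal gi Bg); lra.
    by move=> j y h; apply: (gaps_le_sub _ _ _ _ _ _ _ _ _ _ h) => //; lra.
  + move=> j u v g lv uu ev; have ur : u < r by lra.
    have := cov j u v g lv ur ev; rewrite in_cons => /orP[/eqP[_ uu' _]|//].
    by rewrite uu' ltxx in uu.
  by exists x => //; apply/andP; split=> //; lra.
Qed.

(** * From thickness to distances between gaps *)

Lemma thickness_le_chunk {R : realType} (C : set R) (k p q w delta : R) :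
  0 <= k -> (k%:E <= thickness C)%E -> C p -> C q -> p <= q -> 0 < delta ->
  C w -> ~~ (p <= w <= q) ->
  (forall y, C y -> ~~ (p <= y <= q) -> y <= p - delta \/ q + delta <= y) ->
  k * delta <= q - p.
Proof.
move=> k0 kC Cp Cq pq d0 Cw npw hC.
(* This chunk has diameter at most [q - p] and distance at least [delta] to the rest; [w] makes the
   rest nonempty, without which the infimum would take its default value. *)
pose P := C `&` `[p, q].
have Pp : P p by split=> //; rewrite /= in_itv /= lexx.
have nPw : (C `\` P) w.
  by split=> // -[_]; rewrite /= in_itv /= (negbTE npw).
have ddist : delta <= set_dist P (C `\` P).
  apply: lb_le_inf; first by exists `|p - w|; exists p => //; exists w.
  move=> z [x [_]]; rewrite /= in_itv /= => /andP[px xq] [y [Cy nPy] <-].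
  have ny : ~~ (p <= y <= q).
    by apply/negP => h; apply: nPy; split=> //; rewrite /= in_itv.
  have [h|h] := hC _ Cy ny; rewrite ler_normr; apply/orP; [left|right]; lra.
have Pdiam : diam P <= q - p.
  apply: ge_sup; first by exists `|p - p|; exists p => //; exists p.
  move=> z [x [_]]; rewrite /= in_itv /= => /andP[px xq] [y [_]].
  rewrite /= in_itv /= => /andP[py yq] <-.
  by rewrite ler_norml; apply/andP; split; lra.
have dist0 : 0 < set_dist P (C `\` P) by apply: lt_le_trans ddist.
have PC : chunk C P.
  split=> //; [by exists p, q|by exists p|].
  rewrite properEneq; split; last by move=> x [].
  by apply/eqP => PC; case: nPw => _; rewrite PC.
have : (k%:E <= (diam P / set_dist P (C `\` P))%:E)%E.
  apply: le_trans kC _; rewrite /thickness asboolT; last by exists P.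
  by apply: ereal_inf_lbound; exists P.
rewrite lee_fin ler_pdivlMr // => kd.
by apply: le_trans Pdiam; apply: le_trans kd; rewrite ler_wpM2l.
Qed.

(** The part of [C] between the two gaps is a chunk whose distance to the rest is at least the
    shorter gap. *)
Lemma thick_separated {R : realType} (C : set R) :
  (31%:E <= thickness C)%E -> separated C.
Proof.
move=> tC u v u' v' [Cu Cv uv h] [Cu' Cv' uv' h'] vu'.
apply: (thickness_le_chunk C _ _ _ u) => // {tC}.
- by rewrite lt_min; apply/andP; split; lra.
- by apply/negP => /andP[vu _]; lra.
move=> y Cy; rewrite negb_and -!ltNge => /orP[yv|yv]; [left|right].
  have [yu|uy] := leP y u; last by case: (h y uy yv).
  by have : Num.min (v - u) (v' - u') <= v - u; [rewrite ge_min lexx|lra].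
have [yu|uy] := leP v' y; last by case: (h' y yv uy).
by have : Num.min (v - u) (v' - u') <= v' - u'; [rewrite ge_min lexx orbT|lra].
Qed.

(** The part of [C] from its minimum to the gap is a chunk with neighbours on one side only, so no
    second gap enters the comparison. *)
Lemma thick_gap_left {R : realType} (C : set R) (m u v : R) :
  (31%:E <= thickness C)%E -> C m -> (forall y, C y -> m <= y) ->
  gap C u v -> 31 * (v - u) <= u - m.
Proof.
move=> tC Cm hm [Cu Cv uv h].
apply: (thickness_le_chunk C _ _ _ v) => // {tC}; first exact: hm.
- by lra.
- by apply/negP => /andP[_ vu]; lra.
move=> y Cy; rewrite negb_and -!ltNge => /orP[ym|uy].
  by have := hm _ Cy; lra.
by right; rewrite leNgt; apply/negP => yv; apply: (h y) => //; lra.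
Qed.

Lemma thick_gap_right {R : realType} (C : set R) (M u v : R) :
  (31%:E <= thickness C)%E -> C M -> (forall y, C y -> y <= M) ->
  gap C u v -> 31 * (v - u) <= M - v.
Proof.
move=> tC CM hM [Cu Cv uv h].
apply: (thickness_le_chunk C _ _ _ u) => // {tC}; first exact: hM.
- by lra.
- by apply/negP => /andP[vu _]; lra.
move=> y Cy; rewrite negb_and -!ltNge => /orP[yv|yM].
  by left; rewrite leNgt; apply/negP => yu; apply: (h y) => //; lra.
by have := hM _ Cy; lra.
Qed.

(** * Compactness and translation *)

Lemma compact_extrema {R : realType} (A : set R) : A !=set0 -> compact A ->
  (exists2 m, A m & forall y, A y -> m <= y) /\
  (exists2 M, A M & forall y, A y -> y <= M).
Proof.
move=> A0 cA; have ci : {within A, continuous (@id R)}.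
  by apply: continuous_subspaceT => x; exact: cvg_id.
split.
  have [m /set_mem Am hm] := compact_EVT_min A0 cA ci.
  by exists m => // y Ay; apply/hm/mem_set.
have [M /set_mem AM hM] := compact_EVT_max A0 cA ci.
by exists M => // y Ay; apply/hM/mem_set.
Qed.

Lemma compact_gap {R : realType} (A : set R) (m x M : R) :
  compact A -> A m -> A M -> m <= x <= M -> ~ A x ->
  exists u v, gap A u v /\ u < x < v.
Proof.
move=> cA Am AM /andP[mx xM] nAx.
have cl : compact (A `&` [set y | y <= x]).
  by apply: compact_closedI => //; exact: closed_le.
have cr : compact (A `&` [set y | x <= y]).
  by apply: compact_closedI => //; exact: closed_ge.
have [_ [u [Au /= ux] hu]] := compact_extrema _ (ex_intro _ m (conj Am mx)) cl.
have [[v [Av /= xv] hv] _] := compact_extrema _ (ex_intro _ M (conj AM xM)) cr.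
have ux' : u < x.
  by rewrite lt_neqAle ux andbT; apply/eqP => e; apply: nAx; rewrite -e.
have xv' : x < v.
  by rewrite lt_neqAle xv andbT; apply/eqP => e; apply: nAx; rewrite e.
exists u, v; split; last by rewrite ux'.
split=> //; first lra.
move=> y uy yv Ay; have [yx|xy] := leP y x.
  by have := hu _ (conj Ay yx); lra.
by have := hv _ (conj Ay (ltW xy)); lra.
Qed.

Lemma gap_shift {R : realType} (C : set R) (c u v : R) :
  gap [set x | C (x + c)] u v -> gap C (u + c) (v + c).
Proof.
move=> [Cu Cv uv h]; split=> //; first lra.
by move=> x ux xv Cx; apply: (h (x - c)); rewrite /= ?subrK //; lra.
Qed.

Lemma separated_shift {R : realType} (C : set R) (c : R) :
  separated C -> separated [set x | C (x + c)].
Proof.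
move=> sC u v u' v' /gap_shift g /gap_shift g' vu'.
have := sC _ _ _ _ g g'; rewrite lerD2r => /(_ vu').
have e (x y : R) : x + c - (y + c) = x - y by lra.
by rewrite !e.
Qed.

(** Any cluster point of approximate common points with errors [1 / (n + 1)] works. *)
Lemma compact_common_point {R : realType} (I : Type) (F : I -> set R)
    (l r : R) :
  (forall i, closed (F i)) ->
  (forall e : R, 0 < e -> exists2 x, l <= x <= r &
     forall i, exists2 y, F i y & `|x - y| < e) ->
  exists x, forall i, F i x.
Proof.
move=> clF approx.
have e0 (n : nat) : 0 < n.+1%:R^-1 :> R by rewrite invr_gt0 ltr0n.
pose s n := sval (cid2 (approx _ (e0 n))).
have sI n : l <= s n <= r by rewrite /s; case: cid2.
have sF n i : exists2 y, F i y & `|s n - y| < n.+1%:R^-1.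
  by rewrite /s; case: cid2 => x ? h /=; exact: h.
have FI : (s @ \oo) `[l, r]%classic.
  by exists 0 => // n _ /=; rewrite in_itv; exact: sI.
have [x [_ clx]] := segment_compact _ FI.
exists x => i; apply: clF => U /nbhs_ballP[d /= d0 dU].
have d20 : 0 < d / 2 by lra.
have tail : (s @ \oo) (s @` [set n | n.+1%:R^-1 < d / 2]).
  have : \forall n \near \oo, n.+1%:R^-1 < d / 2 :> R.
    exact: near_infty_natSinv_lt (PosNum d20).
  by apply: filterS => n nd; exists n.
have [_ [[n /= nd <-] xn]] := clx _ _ tail (nbhsx_ballx x _ d20).
have [y Fy ny] := sF n i; exists y; split=> //; apply: dU.
move: xn; rewrite /ball /= => xn; rewrite (splitr d).
rewrite -(subrKA (s n)); apply: le_lt_trans (ler_normD _ _) _.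
by apply: ltrD => //; apply: lt_trans nd.
Qed.

(** * Progressions of a given step in a thick compact set *)

Theorem theorem4p3 (R : realType) (C : set R)
  (hC : cantor_set C)
  (hd : 0 < diam C)
  (htau : (((1 - 15 / 1000) / (2 * (15 / 1000)) : R)%:E <= thickness C)%E) :
  `]0, (3 / 10 * diam C)] `<=` G4AP C.
Proof.
case: hC => C0 cC _ _ t; rewrite /= in_itv /= => /andP[t0 td].
have tC : (31%:E <= thickness C)%E.
  by apply: le_trans htau; rewrite lee_fin ler_pdivlMr; lra.
have [[m Cm hm] [M CM hM]] := compact_extrema _ C0 cC.
have dC : diam C <= M - m.
  apply: ge_sup; first by exists `|m - m|; exists m => //; exists m.
  move=> _ [x Cx [y Cy <-]]; have := hm _ Cx; have := hM _ Cx.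
  have := hm _ Cy; have := hM _ Cy => *.
  by rewrite ler_norml; apply/andP; split; lra.
pose F (i : 'I_4) := [set x | C (x + i%:R * t)].
have clF i : closed (F i).
  apply: closed_comp (compact_closed (@Rhausdorff R) cC) => x _.
  by apply: cvgD; [exact: cvg_id|exact: cvg_cst].
have sepF i : separated (F i) by apply/separated_shift/thick_separated.
have gapL i u v : gap (F i) u v -> 31 * (v - u) <= u + i%:R * t - m.
  by move=> /gap_shift/(thick_gap_left _ _ _ _ tC Cm hm) => {tC htau}; lra.
have gapR i u v : gap (F i) u v -> 31 * (v - u) <= M - (v + i%:R * t).
  by move=> /gap_shift/(thick_gap_right _ _ _ _ tC CM hM) => {tC htau}; lra.
move: tC htau => _ _.
have i4 (i : 'I_4) : 0 <= i%:R * t <= 3 * t.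
  have ? : (i%:R : R) <= 3 by rewrite ler_nat -ltnS.
  apply/andP; split; first by apply: mulr_ge0; rewrite // ltW.
  by apply: ler_wpM2r; rewrite // ltW.
have [x Fx] : exists x, forall i, F i x.
  apply: (compact_common_point _ F m (M - 3 * t) clF) => e e0.
  have [s hs] : exists s : seq ('I_4 * R * R), forall i u v, gap (F i) u v ->
      m < v -> u < M - 3 * t -> e <= v - u -> (i, u, v) \in s.
    (* The interval [[m - 3 t, M]] contains the hulls of all four translates. *)
    have fin i := gaps_finite (F i) e (m - 3 * t) M e0.
    pose f i := sval (cid (fin i)).
    exists (flatten [seq [seq (i, p.1, p.2) | p <- f i] | i <- enum 'I_4]).
    move=> i u v g mv uM ev; apply/flatten_mapP; exists i.
      exact: mem_enum.
    apply/mapP; exists (u, v) => //.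
    rewrite /f; case: cid => /= l; apply=> //.
    - case: g => Cu _ _ _; rewrite /F /= in Cu.
      by have := hm _ Cu; have /andP[] := i4 i; lra.
    - case: g => _ Cv _ _; rewrite /F /= in Cv.
      by have := hM _ Cv; have /andP[] := i4 i; lra.
  pose le_len := [rel p q : 'I_4 * R * R | q.2 - q.1.2 <= p.2 - p.1.2].
  have tot : total le_len by move=> p q; exact: le_total.
  have mM : m < M - 3 * t by lra.
  (* The ends of J are the minimum of [F 0] and the maximum of [F 3], so these two sets start as [a]
     and [b]. *)
  have [||||x xI hx] := escape_large_gaps F e (sort le_len s)
      m (M - 3 * t) ord0 ord_max e0 sepF (sort_sorted tot s) mM.
  - by move=> u v /gapL; rewrite mul0r addr0.
  - by move=> u v /gapR /=; lra.
  (* With [D = M - m], [gapL] for [F 1] and [gapR] for [F 2] give [31 (v - u) < D - 2 t]. This is at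
     most [31 (D - 3 t) / 7] when [79 t <= 24 D], which follows from [t <= 3 D / 10]. *)
  - constructor 2; split=> // j j0 j3 u v g mv uM.
    have := gapL _ _ _ g; have := gapR _ _ _ g.
    have : (j == 1 :> nat) || (j == 2 :> nat).
      by move: j0 j3 {g}; rewrite -!val_eqE /=; case: j => -[|[|[|[|]]]].
    by case/orP => /eqP ->; lra.
  - by move=> i u v g mv uM ev; rewrite mem_sort; exact: hs.
  exists x => // i; have /andP[mx xM] := xI.
  have [Fx|nFx] := pselect (F i x); first by exists x; rewrite ?subrr ?normr0.
  (* Outside [F i], the point [x] lies in a gap of [F i]; having escaped the long gaps, it is within
     [e] of the left endpoint. *)
  have [u' [v' [g' /andP[ux xv]]]] : exists u v,
      gap C u v /\ u < x + i%:R * t < v.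
    apply: (compact_gap _ m _ M) => //.
    by have /andP[] := i4 i => *; apply/andP; split; lra.
  have g : gap (F i) (u' - i%:R * t) (v' - i%:R * t).
    case: g' => Cu Cv uv h; split; rewrite /F /= ?subrK //; first by lra.
    by move=> y uy yv; apply: h; lra.
  exists (u' - i%:R * t); first by case: g.
  rewrite ltNge; apply/negP => ev.
  have xu : 0 <= x - (u' - i%:R * t) by lra.
  have := hx i _ _ g; rewrite ger0_norm // in ev; case/(_ _)/negP; first by lra.
  by apply/andP; split; lra.
split=> //; exists x; split.
- by have := Fx 0; rewrite /F /= mul0r addr0.
- by have := Fx 1; rewrite /F /= mul1r.
- by have := Fx (inord 2); rewrite /F /= inordK.
- by have := Fx (inord 3); rewrite /F /= inordK.
Qed.
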